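(* Let $\hat K\subset\mathbb{R}^d$ be a reference generalized prism and consider its subset $\hat K_\epsilon:=\hat K\cap(\hat K-\epsilon\,\mathrm{e}_d)$, where $\mathrm{e}_d=(0,\dots,0,1)^T$ and $A+z:=\{x+z:\ x\in A\}$ for $A\subset\mathbb{R}^d$, $z\in\mathbb{R}^d$. Then, for all $p\in\mathbb{N}$, all $v\in\mathcal{P}_p(\hat K)$, and any $0<\epsilon\le(8p)^{-2}$, $$\tfrac12\,\|v\|_{\hat K}^2\le\|v\|_{\hat K_\epsilon}^2 .$$
   Context: $\mathbb{N}=\{1,2,\dots\}$; $\|\cdot\|_\omega$ is the $L_2(\omega)$-norm; $\mathcal{P}_p(\omega)$ is the space of polynomials of total degree at most $p$ on $\omega$. Reference generalized prism: let $\hat F^0:=[0,1]^{d-1}$, identified with $[0,1]^{d-1}\times\{0\}\subset\mathbb{R}^d$, and let $\phi:\hat F^0\to\mathbb{R}$ be Lipschitz continuous. A reference generalized prism is a domain $$\hat K\equiv\hat K_\phi:=\{\mathbf{x}\in\mathbb{R}^d:\ 0\le x_i\le1,\ i=1,\dots,d-1,\ 0\le x_d\le\phi(x_1,\dots,x_{d-1})\}$$ with the properties: 1) $[0,1]^d\subset\hat K$; 2) the straight line segment connecting any pair $(\mathbf{x},\mathbf{y})\in\hat F^0\times\hat F$ lies fully in $\hat K$, where $\hat F:=\{\mathbf{x}\in\mathbb{R}^d:\ 0\le x_i\le1,\ i=1,\dots,d-1,\ x_d=\phi(x_1,\dots,x_{d-1})\}$. Standing convention: $\hat\rho:=\sup\{\rho\ge1:\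 \hat F^0\times[0,\rho]\subset\hat K\}=1$. *)

(* Defs.v *)
From HB Require Import structures.
From mathcomp Require Import all_boot all_order all_algebra.
(* mpoly before the analysis libraries and without its notations, which clash
   with theirs. *)
From mathcomp Require Import -(notations) mpoly.
From mathcomp Require Import all_classical all_reals all_analysis.

Set Implicit Arguments.
Unset Strict Implicit.
Unset Printing Implicit Defensive.

Import Order.TTheory GRing.Theory Num.Theory.
Import numFieldNormedType.Exports.

Local Open Scope classical_set_scope.
Local Open Scope ring_scope.

(* The library has the product sigma-algebra on [n.-tuple T] only; this is the
   same construction on row vectors, generated by the coordinate maps. *)
Definition measure_rV_display : measure_display -> measure_display.
Proof. exact. Qed.

Section measurable_rV.
Context {d : measure_display} {T : measurableType d} {n : nat}.

Let coors : 'I_n -> 'rV[T]_n -> T := fun i x => x ord0 i.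

Let rV_set0 : g_sigma_preimage coors set0.
Proof. exact: sigma_algebra0. Qed.

Let rV_setC A : g_sigma_preimage coors A -> g_sigma_preimage coors (~` A).
Proof. exact: sigma_algebraC. Qed.

Let rV_bigcup (F : _^nat) : (forall i, g_sigma_preimage coors (F i)) ->
  g_sigma_preimage coors (\bigcup_i (F i)).
Proof. exact: sigma_algebra_bigcup. Qed.

HB.instance Definition _ := @isMeasurable.Build (measure_rV_display d)
  'rV[T]_n (g_sigma_preimage coors) rV_set0 rV_setC rV_bigcup.

Lemma measurable_rV_coord (i : 'I_n) :
  measurable_fun [set: 'rV[T]_n] (fun x => x ord0 i).
Proof.
move=> _ Y mY; rewrite setTI; apply: sub_sigma_algebra => /=.
rewrite -bigcup_seq/=; exists i => /=; first by rewrite mem_index_enum.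
by exists Y => //; rewrite setTI.
Qed.

Lemma measurable_fun_rVP (d1 : measure_display) (T1 : measurableType d1)
    (f : T1 -> 'rV[T]_n) :
  (forall i, measurable_fun [set: T1] (fun t => f t ord0 i)) ->
  measurable_fun [set: T1] f.
Proof.
move=> mf _ A mA; rewrite setTI.
have : preimage_set_system [set: T1] f (g_sigma_preimage coors) (f @^-1` A).
  by exists A => //; rewrite setTI.
rewrite -g_sigma_preimage_comp; apply: smallest_sub.
  exact: sigma_algebra_measurable.
rewrite -bigcup_seq; apply: bigcup_sub => i _ _ [B mB <-].
exact: mf.
Qed.

End measurable_rV.

Section lebesgue_measure_rV.
Context {R : realType}.

Definition rV_snoc (n : nat) (xt : 'rV[R]_n * measurableTypeR R) :
    'rV[R]_n.+1 :=
  \row_i oapp (xt.1 ord0) xt.2 (unlift ord_max i).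

Definition rV_init (n : nat) (x : 'rV[R]_n.+1) : 'rV[R]_n :=
  \row_i x ord0 (lift ord_max i).

Definition rV_last (n : nat) (x : 'rV[R]_n.+1) : R := x ord0 ord_max.

Lemma rV_initK (n : nat) xt : rV_init (@rV_snoc n xt) = xt.1.
Proof. by apply/rowP => i; rewrite !mxE liftK. Qed.

Lemma rV_lastK (n : nat) xt : rV_last (@rV_snoc n xt) = xt.2.
Proof. by rewrite /rV_last mxE unlift_none. Qed.

Lemma measurable_rV_init (n : nat) : measurable_fun setT (@rV_init n).
Proof.
apply: measurable_fun_rVP => i; under eq_fun do rewrite mxE.
exact: measurable_rV_coord.
Qed.

Lemma measurable_rV_last (n : nat) : measurable_fun setT (@rV_last n).
Proof. exact: measurable_rV_coord. Qed.

Lemma measurable_rV_snoc (n : nat) : measurable_fun setT (@rV_snoc n).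
Proof.
apply: measurable_fun_rVP => i; under eq_fun do rewrite mxE.
case: (unlift ord_max i) => [j|] /=; last exact: measurable_snd.
exact: measurableT_comp (measurable_rV_coord j) measurable_fst.
Qed.

HB.instance Definition _ (n : nat) :=
  isMeasurableFun.Build _ _ _ _ (@rV_snoc n) (@measurable_rV_snoc n).

Section rV_snoc_measure.
Local Open Scope ereal_scope.
Variables (n : nat) (mu : {sigma_finite_measure set 'rV[R]_n -> \bar R}).

Definition rV_snoc_measure : set 'rV[R]_n.+1 -> \bar R :=
  pushforward (mu \x @lebesgue_measure R) (@rV_snoc n).

Let rV_snoc_measure0 : rV_snoc_measure set0 = 0.
Proof. exact: measure0. Qed.

Let rV_snoc_measure_ge0 A : 0 <= rV_snoc_measure A.
Proof. exact: measure_ge0. Qed.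

Let rV_snoc_measure_sigma_additive : semi_sigma_additive rV_snoc_measure.
Proof. exact: measure_semi_sigma_additive. Qed.

HB.instance Definition _ := isMeasure.Build _ _ _ rV_snoc_measure
  rV_snoc_measure0 rV_snoc_measure_ge0 rV_snoc_measure_sigma_additive.

Lemma rV_snoc_measureX (A : set 'rV[R]_n) (B : set R) :
  measurable A -> measurable B ->
  rV_snoc_measure (@rV_init n @^-1` A `&` @rV_last n @^-1` B) =
  mu A * lebesgue_measure B.
Proof.
move=> mA mB; rewrite -product_measure1E// /rV_snoc_measure /pushforward.
congr product_measure1.
by apply/seteqP; split=> xt; rewrite /= rV_initK rV_lastK.
Qed.

Let rV_snoc_measure_sigma_finite : sigma_finite setT rV_snoc_measure.
Proof.
have /sigma_finiteP[F [TF ndF Foo]] := sigma_finiteT mu.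
have /sigma_finiteP[G [TG ndG Goo]] := sigma_finiteT (@lebesgue_measure R).
exists (fun k => @rV_init n @^-1` F k `&` @rV_last n @^-1` G k).
  apply/esym; rewrite -subTset => x _.
  have [k _ Fkx] : (\bigcup_k F k) (rV_init x) by rewrite -TF.
  have [l _ Glx] : (\bigcup_k G k) (rV_last x) by rewrite -TG.
  exists (maxn k l) => //; split.
  - by have /subsetPset := ndF _ _ (leq_maxl k l); exact.
  - by have /subsetPset := ndG _ _ (leq_maxr k l); exact.
move=> k; have [mF ltF] := Foo k; have [mG ltG] := Goo k; split.
  apply: measurableI; rewrite -[X in measurable X]setTI.
  - exact: measurable_rV_init.
  - exact: measurable_rV_last.
by rewrite rV_snoc_measureX// lte_mul_pinfty// ge0_fin_numE.
Qed.

HB.instance Definition _ := @Measure_isSigmaFinite.Build _ _ _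
  rV_snoc_measure rV_snoc_measure_sigma_finite.

End rV_snoc_measure.

(* n-fold product of the Lebesgue measure on R; [lebesgue_measure_rV_box] gives
   its values on boxes, which determine it. *)
Fixpoint lebesgue_measure_rV (n : nat) :
    {sigma_finite_measure set 'rV[R]_n -> \bar R} :=
  match n with
  | 0 => dirac (0 : 'rV[R]_0)
  | n'.+1 => rV_snoc_measure (lebesgue_measure_rV n')
  end.

Lemma lebesgue_measure_rV_box (n : nat) (A : 'I_n -> set R) :
  (forall i, measurable (A i)) ->
  lebesgue_measure_rV n [set x | forall i, A i (x ord0 i)] =
  (\prod_(i < n) lebesgue_measure (A i))%E.
Proof.
have m_coord m (B : 'I_m -> set R) : (forall i, measurable (B i)) ->
    measurable [set x : 'rV[R]_m | forall i, B i (x ord0 i)].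
  move=> mB.
  rewrite [X in measurable X](_ : _ =
      \bigcap_(i in [set: 'I_m]) (fun x : 'rV[R]_m => x ord0 i) @^-1` B i).
    apply: fin_bigcap_measurable => // i _.
    by rewrite -[X in measurable X]setTI; exact: measurable_rV_coord.
  by apply/seteqP; split=> [x Bx i _|x Bx i]; [exact: Bx|exact: (Bx i)].
elim: n A => [|n IHn] A mA.
  by rewrite big_ord0 /= diracE mem_set//= => -[].
rewrite big_ord_recr /=.
transitivity (lebesgue_measure_rV n
    [set x | forall i : 'I_n, A (widen_ord (leqnSn n) i) (x ord0 i)] *
    lebesgue_measure (A ord_max))%E; last first.
  by congr (_ * _)%E; apply: IHn.
rewrite -rV_snoc_measureX//; last first.
  by apply: (m_coord n (fun i => A (widen_ord (leqnSn n) i))).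
have liftE (i : 'I_n) : lift ord_max i = widen_ord (leqnSn n) i.
  by apply/val_inj; exact: lift_max.
congr (rV_snoc_measure _ _); apply/seteqP; split=> [x Ax|x [/= Ax Am] i].
  by split=> [i|]; rewrite /= ?mxE ?liftE; exact: Ax.
have [j ->|->] := unliftP ord_max i; last exact: Am.
by have := Ax j; rewrite mxE liftE.
Qed.

End lebesgue_measure_rV.

Section generalized_prism.
Context {R : realType}.

(* Below d = n.+1: for a point x of R^d, rV_init x is (x_1, ..., x_(d-1)) and
   rV_last x is x_d. *)

Definition unit_cube (n : nat) : set 'rV[R]_n :=
  [set x | forall i, 0 <= x ord0 i <= 1].

Definition bottom_face (n : nat) : set 'rV[R]_n.+1 :=
  [set x | unit_cube (rV_init x) /\ rV_last x = 0].

Definition top_face (n : nat) (phi : 'rV[R]_n -> R) : set 'rV[R]_n.+1 :=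
  [set x | unit_cube (rV_init x) /\ rV_last x = phi (rV_init x)].

Definition gen_prism (n : nat) (phi : 'rV[R]_n -> R) : set 'rV[R]_n.+1 :=
  [set x | unit_cube (rV_init x) /\ 0 <= rV_last x <= phi (rV_init x)].

Definition segment (V : lmodType R) (x y : V) : set V :=
  [set (1 - t) *: x + t *: y | t in [set t : R | 0 <= t <= 1]].

(* Row vectors carry the maximum norm; Lipschitz continuity does not depend on
   the choice of the norm. *)
Definition reference_prism (n : nat) (K : set 'rV[R]_n.+1) : Prop :=
  exists phi : 'rV[R]_n -> R,
    [/\ [lipschitz phi x | x in @unit_cube n],
        K = gen_prism phi,
        @unit_cube n.+1 `<=` K &
        forall x y, bottom_face x -> top_face phi y -> segment x y `<=` K].

Definition cylinder (n : nat) (rho : R) : set 'rV[R]_n.+1 :=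
  [set x | unit_cube (rV_init x) /\ 0 <= rV_last x <= rho].

Definition rho_hat (n : nat) (K : set 'rV[R]_n.+1) : R :=
  sup [set rho | 1 <= rho /\ cylinder rho `<=` K].

Definition translate (V : zmodType) (A : set V) (z : V) : set V :=
  [set x + z | x in A].

Definition e_last (n : nat) : 'rV[R]_n.+1 := delta_mx ord0 ord_max.

Definition shrunk_prism (n : nat) (K : set 'rV[R]_n.+1) (eps : R) :
    set 'rV[R]_n.+1 :=
  K `&` translate K (- (eps *: e_last n)).

(* Since msize is the total degree plus one (and 0 for the zero polynomial),
   the bound on msize says that the total degree is at most p. *)
Definition poly_space (d p : nat) (omega : set 'rV[R]_d) :
    set ('rV[R]_d -> R) :=
  [set v | exists P : mpoly.mpoly d R,
     (mpoly.msize P <= p.+1)%N /\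
     forall x, omega x -> v x = mpoly.meval (x ord0) P].

Definition L2norm (d : nat) (omega : set 'rV[R]_d) (v : 'rV[R]_d -> R) :
    \bar R :=
  'N[lebesgue_measure_rV d]_2%:E [EFin \o (v \_ omega)].

End generalized_prism.

(* Main.v *)
Require Import Defs.
From HB Require Import structures.
From mathcomp Require Import all_boot all_order all_algebra.
From mathcomp Require Import -(notations) mpoly.
From mathcomp Require Import all_classical all_reals all_analysis.
From mathcomp Require Import measurable_realfun.
From mathcomp Require Import ring lra.

Set Implicit Arguments.
Unset Strict Implicit.
Unset Printing Implicit Defensive.

Local Open Scope classical_set_scope.
Local Open Scope ring_scope.

Import Order.TTheory GRing.Theory Num.Theory.
Import numFieldNormedType.Exports.

(* On each vertical line, with x' in the cube fixed, v is a polynomial q of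
   degree at most p in the last variable t, K is the interval [0, L] with
   L = phi x' >= 1, and the shrunk prism is [0, L - eps]; by Tonelli it suffices
   that the integral of q^2 over [0, L] is at most twice that over [0, L - eps].
   The reproducing kernel k of the polynomials of degree at most p at the
   endpoint x of [0, x] is a multiple of the (p+1)-st derivative of
   t^(p+1) (t - x)^p (integrate by parts p+1 times), and k(x) = (p+1)^2 / x, so
   that q(x)^2 <= (p+1)^2 / x * int_0^x q^2.  For x in [L - eps, L] this bounds
   q(x)^2 by 8 p^2 int_0^L q^2, and eps <= 1 / (64 p^2). *)

(** * Formal antiderivatives of polynomials, standing for integrals from 0 *)

Section antiderivative.
Variable R : numFieldType.
Implicit Types p q : {poly R}.

(* The coefficient of index 0 is [q`_0 / 0 = 0]. *)
Definition antideriv q : {poly R} :=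
  \poly_(i < (size q).+1) (q`_i.-1 / i%:R).

Lemma coef_antideriv q i : (antideriv q)`_i = q`_i.-1 / i%:R.
Proof.
rewrite coef_poly; case: ltnP => // lt_qi.
by rewrite nth_default ?mul0r// -ltnS (leq_trans lt_qi)// leqSpred.
Qed.

Lemma antideriv_is_linear : linear antideriv.
Proof.
move=> a p q; apply/polyP => i.
by rewrite coefD coefZ !coef_antideriv coefD coefZ mulrDl mulrA.
Qed.

HB.instance Definition _ :=
  GRing.isLinear.Build R {poly R} {poly R} _ antideriv antideriv_is_linear.

Lemma deriv_antideriv q : (antideriv q)^`() = q.
Proof.
by apply/polyP => i; rewrite coef_deriv coef_antideriv
  -[LHS]mulr_natr divfK// pnatr_eq0.
Qed.

Lemma antideriv_deriv q : antideriv q^`() = q - (q`_0)%:P.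
Proof.
apply/polyP => -[|i]; rewrite coef_antideriv coefB coefC/= ?subrr ?invr0.
  by rewrite mulr0.
by rewrite subr0 coef_deriv -[X in X / _]mulr_natr mulfK// pnatr_eq0.
Qed.

Lemma antideriv0 q : (antideriv q).[0] = 0.
Proof. by rewrite horner_coef0 coef_antideriv invr0 mulr0. Qed.

Lemma antideriv_deriv_horner q x : (antideriv q^`()).[x] = q.[x] - q.[0].
Proof. by rewrite antideriv_deriv hornerD hornerN hornerC horner_coef0. Qed.

End antiderivative.

(** * Integration by parts and the reproducing kernel at an endpoint *)

Section endpoint_kernel.
Variable R : numFieldType.
Implicit Types (q w : {poly R}) (p : nat).

(** Each induction step integrates by parts once: the boundary terms at 0 vanish, and so do those at
    [L], except the one with the m-th derivative of [w]. In the base case [q] is constant. *)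
Lemma antideriv_derivn_mul w q (m : nat) (L : R) :
  (size q <= m.+1)%N -> (forall i, (i <= m)%N -> w^`(i).[0] = 0) ->
  (forall i, (i < m)%N -> w^`(i).[L] = 0) ->
  (antideriv (w^`(m.+1) * q)).[L] = w^`(m).[L] * q.[L].
Proof.
elim: m q => [|m IH] q sq w0 wL.
  rewrite (size1_polyC sq) mulrC -alg_polyC -scalerAl mul1r linearZ/= hornerZ.
  by rewrite antideriv_deriv_horner (w0 0)// subr0 hornerZ hornerC mulr1 mulrC.
have sq' : (size q^`() <= m.+1)%N.
  have [->|q0] := eqVneq q 0; first by rewrite deriv0 size_poly0.
  by rewrite -ltnS (leq_trans (lt_size_deriv q0)).
have -> : w^`(m.+2) * q = (w^`(m.+1) * q)^`() - w^`(m.+1) * q^`().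
  by rewrite derivM -derivnS addrK.
rewrite linearB/= hornerD hornerN antideriv_deriv_horner.
rewrite (IH q^`() sq') => [|i im|i im]; last 2 first.
- by apply: w0; rewrite (leq_trans im).
- by apply: wL; rewrite (leq_trans im).
by rewrite !hornerM -!derivnS w0// (wL m)// !mul0r !subr0.
Qed.

(** The factored form lets the inductions on [n] below absorb the derivative into the cofactor. *)
Lemma deriv_mul_XsubC_expS w (a : R) n :
  (w * ('X - a%:P) ^+ n.+1)^`() =
  (w^`() * ('X - a%:P) + w *+ n.+1) * ('X - a%:P) ^+ n.
Proof.
rewrite derivM deriv_exp derivB derivX derivC subr0 mul1r exprS mulrA.
by rewrite mulrDl mulrnAr mulrnAl.
Qed.

Lemma derivn_mul_XsubC_exp_lt w (a : R) n i : (i < n)%N ->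
  (w * ('X - a%:P) ^+ n)^`(i).[a] = 0.
Proof.
elim: n w i => // n IH w [_|i lt_in]; last first.
  by rewrite derivSn deriv_mul_XsubC_expS IH.
by rewrite derivn0 hornerM horner_exp !hornerE subrr expr0n mulr0.
Qed.

(** At [a] the product expands as w(a) (X - a)^n + w'(a) (X - a)^(n+1) + ...; this lemma and the
    next read off these two Taylor coefficients. *)
Lemma derivn_mul_XsubC_exp w (a : R) n :
  (w * ('X - a%:P) ^+ n)^`(n).[a] = w.[a] *+ n`!.
Proof.
elim: n w => [|n IH] w; first by rewrite derivn0 mulr1 fact0 mulr1n.
rewrite derivSn deriv_mul_XsubC_expS IH !hornerE subrr mulr0 add0r hornerMn.
by rewrite -mulrnA factS.
Qed.

Lemma derivnS_mul_XsubC_exp w (a : R) n :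
  (w * ('X - a%:P) ^+ n)^`(n.+1).[a] = w^`().[a] *+ n.+1`!.
Proof.
elim: n w => [|n IH] w; first by rewrite mulr1 derivn1 factS fact0 mulr1n.
(* The new cofactor w' (X - a) + (n+1) w has derivative (n+2) w'(a) at [a]. *)
rewrite derivSn deriv_mul_XsubC_expS IH derivD derivM derivMn derivB derivX.
rewrite derivC subr0 mulr1 !hornerE subrr mulr0 add0r hornerMn -mulrS -mulrnA.
by rewrite (factS n.+1).
Qed.

(* Reproducing kernel, at the endpoint [L], of the polynomials of degree at most
   [p] in L2(0, L), written in the manner of Rodrigues' formula. *)
Definition endpoint_kernel (p : nat) (L : R) : {poly R} :=
  (p`!%:R * L ^+ p.+1)^-1 *: ('X^(p.+1) * ('X - L%:P) ^+ p)^`(p.+1).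

(** Degree 2p+1 drops to p after p+1 derivatives, so the kernel reproduces itself as well. *)
Lemma size_endpoint_kernel p L : (size (endpoint_kernel p L) <= p.+1)%N.
Proof.
have sD (r : {poly R}) i : (size r^`(i) <= size r - i)%N.
  elim: i => [|i IH]; first by rewrite derivn0 subn0.
  by rewrite derivnS subnS (leq_trans (size_poly _ _))// -!subn1 leq_sub2r.
rewrite (leq_trans (size_scale_leq _ _))// (leq_trans (sD _ _))// leq_subLR.
rewrite (leq_trans (size_polyMleq _ _))// size_polyXn size_exp_XsubC.
by rewrite addSn.
Qed.

(** The differentiated product vanishes to order p+1 at 0 and p at [L]; the surviving boundary
    factor p! L^(p+1) is cancelled by the normalization. *)
Lemma endpoint_kernelP p L q : 0 < L -> (size q <= p.+1)%N ->
  (antideriv (endpoint_kernel p L * q)).[L] = q.[L].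
Proof.
move=> L0 sq; rewrite -scalerAl linearZ/= hornerZ antideriv_derivn_mul//.
- rewrite derivn_mul_XsubC_exp hornerXn -(mulr_natl (L ^+ p.+1)) mulrA.
  rewrite mulVf ?mul1r//.
  by rewrite mulf_neq0 ?expf_neq0 ?gt_eqF// ltr0n fact_gt0.
- move=> i ip; rewrite mulrC -['X]subr0 -['X - 0]/('X - 0%:P).
  by rewrite derivn_mul_XsubC_exp_lt.
- by move=> i ip; rewrite derivn_mul_XsubC_exp_lt.
Qed.

(** One factor p+1 comes from differentiating X^(p+1), the other from (p+1)! / p!. *)
Lemma endpoint_kernel_endpoint p L : 0 < L ->
  (endpoint_kernel p L).[L] = p.+1%:R ^+ 2 / L.
Proof.
move=> L0; rewrite hornerZ derivnS_mul_XsubC_exp derivXn/= hornerMn hornerXn.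
rewrite -mulrnA -(mulr_natl (L ^+ p)) natrM factS natrM exprS.
have /gt_eqF fp : 0 < p`!%:R :> R by rewrite ltr0n fact_gt0.
have /gt_eqF Lp : 0 < L ^+ p by rewrite exprn_gt0.
by field; rewrite Lp fp gt_eqF.
Qed.

End endpoint_kernel.

(** * The estimate on an interval *)

Section one_dimensional_estimate.
Variable R : realType.
Implicit Types q : {poly R}.

Lemma horner_MVT q (a b : R) : a <= b ->
  exists2 c, c \in `[a, b] & q.[b] - q.[a] = q^`().[c] * (b - a).
Proof.
move=> ab; apply: (@MVT_segment _ (horner q) (horner q^`())) => //.
by apply: continuous_subspaceT => x; exact: continuous_horner.
Qed.

Lemma antideriv_sqr_homo q (a b : R) : a <= b ->
  (antideriv (q ^+ 2)).[a] <= (antideriv (q ^+ 2)).[b].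
Proof.
move=> ab; rewrite -subr_ge0.
have [c _ ->] := horner_MVT (antideriv (q ^+ 2)) ab.
by rewrite deriv_antideriv horner_exp mulr_ge0 ?sqr_ge0 ?subr_ge0.
Qed.

(** Cauchy-Schwarz for [q] and the kernel [k]: the squared distance from [q] to its projection on
    [k] is nonnegative, and M = k(L) is the squared norm of [k] by reproduction. *)
Lemma endpoint_inequality (p : nat) q (L : R) : 0 < L -> (size q <= p.+1)%N ->
  q.[L] ^+ 2 <= p.+1%:R ^+ 2 / L * (antideriv (q ^+ 2)).[L].
Proof.
move=> L0 sq; set k := endpoint_kernel p L; set M := p.+1%:R ^+ 2 / L.
have M0 : 0 < M by rewrite divr_gt0// exprn_gt0 ?ltr0n.
have : 0 <= (antideriv ((q - (q.[L] / M) *: k) ^+ 2)).[L].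
  rewrite -(antideriv0 ((q - (q.[L] / M) *: k) ^+ 2)).
  by rewrite antideriv_sqr_homo// ltW.
have -> : (q - (q.[L] / M) *: k) ^+ 2 =
    q ^+ 2 - (q.[L] / M) *: ((k * q) *+ 2 - (q.[L] / M) *: (k * k)).
  by rewrite -!mul_polyC; ring.
rewrite !(linearB, linearZ, linearMn)/= !(hornerE, hornerMn).
rewrite !endpoint_kernelP ?size_endpoint_kernel// endpoint_kernel_endpoint//.
rewrite -/M => pos; rewrite mulrC -ler_pdivrMr// -subr_ge0 (le_trans pos)//.
by rewrite le_eqVlt; apply/orP; left; apply/eqP; field; rewrite gt_eqF.
Qed.

Lemma antideriv_sqr_shrink (p : nat) q (L eps : R) : (0 < p)%N ->
  (size q <= p.+1)%N -> 1 <= L -> 0 < eps -> eps <= (8 * p%:R) ^- 2 ->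
  (antideriv (q ^+ 2)).[L] <= 2 * (antideriv (q ^+ 2)).[L - eps].
Proof.
move=> p0 sq L1 e0 le_e; set F := antideriv (q ^+ 2).
have p1 : 1 <= p%:R :> R by rewrite ler1n.
have ep : eps * p%:R ^+ 2 <= 64^-1.
  rewrite -ler_pdivlMr ?exprn_gt0 ?ltr0n// (le_trans le_e)// exprMn invfM.
  by rewrite ler_wpM2r// ?invr_ge0 ?exprn_ge0// lef_pV2 ?posrE//; lra.
have e64 : eps <= 64^-1.
  by rewrite (le_trans _ ep)// ler_peMr ?(ltW e0)// exprn_ege1.
have [c] : exists2 c, c \in `[L - eps, L] &
    F.[L] - F.[L - eps] = F^`().[c] * (L - (L - eps)).
  by apply: horner_MVT; lra.
rewrite in_itv/= => /andP[cl cu].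
rewrite deriv_antideriv horner_exp subKr => FE.
have c0 : 2^-1 < c by lra.
have FL0 : 0 <= F.[L].
  by rewrite -(antideriv0 (q ^+ 2)) antideriv_sqr_homo//; lra.
have FcL : F.[c] <= F.[L] by exact: antideriv_sqr_homo.
have Fc0 : 0 <= F.[c].
  by rewrite -(antideriv0 (q ^+ 2)) antideriv_sqr_homo//; lra.
have qc : q.[c] ^+ 2 <= 8 * p%:R ^+ 2 * F.[L].
  have c0' : 0 < c by lra.
  rewrite (le_trans (endpoint_inequality c0' sq))// ler_pM//.
    by rewrite divr_ge0 ?sqr_ge0// ltW.
  rewrite ler_pdivrMr// -natr1.
  (* This says 4 p^2 <= 8 p^2 c, while (p+1)^2 <= 4 p^2 as p >= 1. *)
  have : 0 <= p%:R ^+ 2 * (c - 2^-1) by rewrite mulr_ge0 ?sqr_ge0//; lra.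
  nra.
have : q.[c] ^+ 2 * eps <= 8 * (eps * p%:R ^+ 2) * F.[L].
  by rewrite [leRHS](_ : _ = 8 * p%:R ^+ 2 * F.[L] * eps) ?ler_pM2r//; ring.
have : 8 * (eps * p%:R ^+ 2) * F.[L] <= 8 * 64^-1 * F.[L].
  by rewrite ler_wpM2r// ler_pM2l//; lra.
(* The removed part is at most F(L) / 8, so F(L) <= (8/7) F(L - eps). *)
lra.
Qed.

Lemma integral_sqr_horner q (b : R) : 0 < b ->
  (\int[lebesgue_measure]_(t in `[0%R, b]) ((q.[t] ^+ 2)%:E) =
   (antideriv (q ^+ 2)).[b]%:E)%E.
Proof.
move=> b0.
transitivity ((antideriv (q ^+ 2)).[b]%:E - (antideriv (q ^+ 2)).[0]%:E)%E;
  last by rewrite antideriv0 sube0.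
under eq_integral do rewrite -horner_exp.
apply: continuous_FTC2 => //.
- by apply: continuous_subspaceT => x; exact: continuous_horner.
- split => [x _||]; first exact: derivable_horner.
  + by apply: cvg_at_right_filter; exact: continuous_horner.
  + by apply: cvg_at_left_filter; exact: continuous_horner.
- by move=> x _; rewrite -derivE deriv_antideriv.
Qed.

End one_dimensional_estimate.

(** * Measurability of the cube, of polynomials and of prisms *)

Section measurability.
Variable R : realType.

Lemma measurable_rV_box (n : nat) (B : 'I_n -> set R) :
  (forall i, measurable (B i)) ->
  measurable [set x : 'rV[R]_n | forall i, B i (x ord0 i)].
Proof.
move=> mB; rewrite [X in measurable X](_ : _ =
    \bigcap_(i in [set: 'I_n]) (fun x : 'rV[R]_n => x ord0 i) @^-1` B i).
  apply: fin_bigcap_measurable => // i _.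
  by rewrite -[X in measurable X]setTI; exact: measurable_rV_coord.
by apply/seteqP; split=> [x Bx i _|x Bx i]; [exact: Bx|exact: (Bx i)].
Qed.

Lemma measurable_unit_cube (n : nat) : measurable (@unit_cube R n).
Proof.
rewrite (_ : unit_cube (n := n) =
    [set x | forall i, `[0, 1]%classic (x ord0 i)]); last first.
  by apply/seteqP; split => x /= H i; have := H i; rewrite /= in_itv.
exact: (measurable_rV_box (fun=> measurable_itv _)).
Qed.

Lemma measurable_meval (n : nat) (P : mpoly.mpoly n R) :
  measurable_fun setT (fun x : 'rV[R]_n => mpoly.meval (x ord0) P).
Proof.
under eq_fun do rewrite mpoly.mevalE.
apply: measurable_sum => m; apply: measurable_funM => //.
apply: measurable_prod => i _; apply: measurable_funX.
exact: measurable_rV_coord.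
Qed.

Lemma rV_norm_le (n : nat) (x : 'rV[R]_n) (r : R) : 0 <= r ->
  (forall i, `|x ord0 i| <= r) -> `|x| <= r.
Proof.
move=> r0 xr; rewrite -[`|x|]/(mx_norm x).
have [->//|/mx_norm_neq0[[i j] ->]] := eqVneq (mx_norm x) 0.
by rewrite (ord1 i).
Qed.

(* Each strict sublevel set is a countable union of traces on the cube of small
   closed boxes centred at grid points. *)
Lemma lipschitz_measurable (n : nat) (phi : 'rV[R]_n -> R) :
  [lipschitz phi x | x in @unit_cube R n] ->
  measurable_fun (@unit_cube R n) phi.
Proof.
(* The Lipschitz bound is given for every constant above some [M], so [C] is taken strictly above
   [M] and positive. *)
move=> [M [_ HM]]; pose C := Num.max M 0 + 1.
have C0 : 0 < C by rewrite ltr_wpDl// le_max lexx orbT.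
have phiC x y : unit_cube x -> unit_cube y -> `|phi x - phi y| <= C * `|x - y|.
  move=> cx cy; apply: (HM C _ (x, y)) => //.
  by rewrite /C ltr_pwDr// le_max lexx.
(* With m+2 indices per coordinate the grid values are 0, 1/(m+1), ..., 1, both ends included. *)
pose grid m (k : {ffun 'I_n -> 'I_m.+2}) : 'rV[R]_n :=
  \row_i ((k i)%:R / m.+1%:R).
have grid_cube m k : unit_cube (grid m k).
  move=> i; rewrite mxE divr_ge0//= ler_pdivrMr ?ltr0n// mul1r ler_nat.
  by rewrite -ltnS.
pose near_grid m k := [set x : 'rV[R]_n | forall i,
  `[grid m k ord0 i - m.+1%:R^-1, grid m k ord0 i + m.+1%:R^-1]%classic
    (x ord0 i)].
have near_gridP m k x : near_grid m k x -> `|x - grid m k| <= m.+1%:R^-1.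
  move=> xk; apply: rV_norm_le => // i; have := xk i.
  by rewrite /= in_itv/= !mxE ler_distl.
have near_gridE m x : unit_cube x -> exists k, near_grid m k x.
  move=> cx; have lt_k i : (Num.trunc (m.+1%:R * x ord0 i) < m.+2)%N.
    have /andP[x0 x1] := cx i.
    rewrite truncn_lt_nat ?mulr_ge0// -[m.+2]addn1 natrD.
    by rewrite (@le_lt_trans _ _ m.+1%:R) ?ltrDl// ler_piMr.
  (* The index rounds (m+1) x_i down. *)
  exists [ffun i => Ordinal (lt_k i)] => i /=; rewrite in_itv/= mxE ffunE/=.
  have /andP[x0 _] := cx i.
  have /andP[lo up] := truncn_itv (mulr_ge0 (ler0n R m.+1) x0).
  move: (Num.trunc _) lo up => t lo up.
  rewrite -[X in _ <= X <= _](@mulKf _ m.+1%:R) ?pnatr_eq0// (mulrC _^-1).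
  rewrite -[X in _ - X <= _]mul1r -[X in _ <= _ + X]mul1r -mulrBl -mulrDl.
  rewrite !ler_pM2r ?invr_gt0 ?ltr0n//.
  by move: up; rewrite -(natr1 t) => up; apply/andP; split; lra.
apply: (measurability _ (RGenInftyO.measurableE R)) => _ [_ [a ->] <-].
(* A box is kept when [phi] at its centre lies below [a] by more than C / (m+1), which forces phi <
   a on its trace on the cube. *)
rewrite (_ : _ `&` _ = @unit_cube R n `&` \bigcup_m
    \bigcup_(k in [set k | phi (grid m k) + C / m.+1%:R < a]) near_grid m k).
  apply: measurableI; first exact: measurable_unit_cube.
  apply: bigcup_measurable => m _; apply: fin_bigcup_measurable => // k _.
  exact: (measurable_rV_box (fun=> measurable_itv _)).
apply/seteqP; split => x [cx /=]; rewrite in_itv/= => xa; split => //.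
(* The factor 2 pays for both the variation of [phi] from x to the grid point and the margin
   required of a kept box. *)
- have e0 : 0 < (a - phi x) / (2 * C) by rewrite divr_gt0 ?subr_gt0 ?mulr_gt0.
  have e0' : 0 < ((a - phi x) / (2 * C))^-1 by rewrite invr_gt0.
  have [m me] : exists m, m.+1%:R^-1 < (a - phi x) / (2 * C).
    exists (Num.trunc ((a - phi x) / (2 * C))^-1).
    rewrite invf_plt ?posrE ?ltr0n//.
    by have /andP[] := truncn_itv (ltW e0').
  have [k xk] := near_gridE m x cx; exists m => //; exists k => //=.
  have := phiC _ _ cx (grid_cube m k).
  have := near_gridP _ _ _ xk; rewrite -(ler_pM2l C0) => dC.
  move=> /le_trans/(_ dC); rewrite ler_distl => /andP[+ _].
  move: me; rewrite ltr_pdivlMr ?mulr_gt0//; move: (phi (grid m k)) (_^-1).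
  by move=> y e; lra.
- have [m _ [k /= ka xk]] := xa.
  have := phiC _ _ cx (grid_cube m k).
  have := near_gridP _ _ _ xk; rewrite -(ler_pM2l C0) => dC.
  move=> /le_trans/(_ dC); rewrite ler_distl => /andP[_ /le_lt_trans]; exact.
Qed.

Lemma measurable_gen_prism (n : nat) (psi : 'rV[R]_n -> R) :
  measurable_fun (@unit_cube R n) psi -> measurable (gen_prism psi).
Proof.
have mU := @measurable_unit_cube n.
(* Measurability of [psi] is known on the cube only; its extension by 0 is measurable everywhere and
   defines the same prism. *)
move=> /(measurable_restrictT _ mU) mpsi.
rewrite (_ : gen_prism psi = @rV_init R n @^-1` (@unit_cube R n) `&`
    ([set x | 0 <= rV_last x] `&`
     [set x | rV_last x <= (psi \_ (@unit_cube R n)) (rV_init x)])).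
  apply: measurableI.
    by rewrite -[X in measurable X]setTI; exact: measurable_rV_init.
  apply: measurableI; rewrite -[X in measurable X]setTI.
  - by apply: measurable_fun_le => //; exact: measurable_rV_last.
  - apply: measurable_fun_le => //; first exact: measurable_rV_last.
    exact: measurableT_comp mpsi (@measurable_rV_init R n).
apply/seteqP; split => x /= [cx].
- by move=> /andP[]; rewrite patchE mem_set.
- by rewrite patchE mem_set// => -[x0 xpsi]; split => //; apply/andP.
Qed.

End measurability.

(** * Slicing into vertical lines *)

Section fibers.
Variable R : realType.

Definition fiber_poly (n : nat) (P : mpoly n.+1 R) (x : 'rV[R]_n) :
    {poly R} :=
  \sum_(m <- msupp P) (mcoeff m P *
    \prod_(i < n) x ord0 i ^+ fun_of_multinom m (lift ord_max i)) *:
    'X^(fun_of_multinom m ord_max).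

Lemma horner_fiber_poly (n : nat) (P : mpoly n.+1 R) (x : 'rV[R]_n) t :
  (fiber_poly P x).[t] = meval (rV_snoc (x, t) ord0) P.
Proof.
rewrite mevalE horner_sum; apply: eq_bigr => m _.
rewrite hornerZ hornerXn -mulrA; congr (_ * _).
rewrite big_ord_recr /= mxE unlift_none/=; congr (_ * _).
apply: eq_bigr => i _.
have <- : lift ord_max i = widen_ord (leqnSn n) i.
  by apply/val_inj; exact: lift_max.
by rewrite mxE liftK.
Qed.

(** The exponent of one variable is at most the total degree of its monomial. *)
Lemma size_fiber_poly (n : nat) (P : mpoly n.+1 R) (x : 'rV[R]_n) :
  (size (fiber_poly P x) <= msize P)%N.
Proof.
rewrite (leq_trans (size_sum _ _ _))//; apply/bigmax_leqP_seq => m mP _.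
rewrite (leq_trans (size_scale_leq _ _))// size_polyXn.
apply: leq_ltn_trans (msize_mdeg_lt mP).
by rewrite mdegE (bigD1 ord_max)//= leq_addr.
Qed.

Lemma L2norm_sqr (d : nat) (A : set 'rV[R]_d) (v : 'rV[R]_d -> R) :
  (L2norm A v ^+ 2 =
   \int[@lebesgue_measure_rV R d]_x ((v \_ A) x ^+ 2)%:E)%E.
Proof.
rewrite /L2norm unlock poweR12_sqrt ?sqr_sqrte.
- by apply: eq_integral => x _; rewrite /= powR_mulrn ?real_normK ?num_real.
- by apply: integral_ge0 => x _; exact: poweR_ge0.
- by apply: integral_ge0 => x _; exact: poweR_ge0.
Qed.

(** Tonelli: the measure in dimension n+1 is by definition the pushforward of a product measure
    under [rV_snoc]. *)
Lemma integral_rV_snoc (n : nat) (f : 'rV[R]_n.+1 -> \bar R) :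
  measurable_fun setT f -> (forall x, (0 <= f x)%E) ->
  (\int[@lebesgue_measure_rV R n.+1]_y f y =
   \int[@lebesgue_measure_rV R n]_x
     \int[@lebesgue_measure R]_t f (rV_snoc (x, t)))%E.
Proof.
move=> mf f0.
transitivity (\int[pushforward (@lebesgue_measure_rV R n \x @lebesgue_measure R)
    (@rV_snoc R n)]_y f y)%E; first by [].
rewrite (ge0_integral_pushforward (@measurable_rV_snoc R n))//.
rewrite preimage_setT fubini_tonelli1//.
  by apply: measurableT_comp mf _; exact: measurable_rV_snoc.
by move=> z; exact: f0.
Qed.

(** The fiber over [x] is [0, psi x], and the restricted [v] is 0 on the rest of the line. *)
Lemma integral_fiber (n : nat) (psi : 'rV[R]_n -> R) (P : mpoly n.+1 R)
    (v : 'rV[R]_n.+1 -> R) (x : 'rV[R]_n) :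
  (forall y, gen_prism psi y -> v y = meval (y ord0) P) ->
  unit_cube x -> 0 < psi x ->
  (\int[@lebesgue_measure R]_t ((v \_ (gen_prism psi)) (rV_snoc (x, t)) ^+ 2)%:E
   = (antideriv (fiber_poly P x ^+ 2)).[psi x]%:E)%E.
Proof.
move=> vP cx psi0; rewrite -integral_sqr_horner// [RHS]integral_mkcond.
apply: eq_integral => t _; rewrite !patchE.
have memE : (rV_snoc (x, t) \in gen_prism psi) = (t \in `[0%R, psi x]%classic).
  apply/idP/idP; rewrite !inE /gen_prism/= rV_initK rV_lastK in_itv/=.
  - by case.
  - by move=> tpsi; split.
rewrite memE; case: ifPn => [tpsi|_]; last by rewrite expr0n.
by rewrite vP ?horner_fiber_poly//; move: memE; rewrite tpsi => /set_mem.
Qed.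

(** Off [A] the function [v] is arbitrary, so it is first replaced by [P], which has the same
    restriction to [A]. *)
Lemma measurable_patch_meval (d : nat) (A : set 'rV[R]_d) (v : 'rV[R]_d -> R)
    (P : mpoly d R) : measurable A ->
  (forall y, A y -> v y = meval (y ord0) P) ->
  measurable_fun setT (fun y => ((v \_ A) y ^+ 2)%:E).
Proof.
move=> mA vP; apply/measurable_EFinP; apply: measurable_funX.
rewrite (_ : v \_ A = (fun y => meval (y ord0) P) \_ A).
  apply/(measurable_restrictT _ mA); apply: measurable_funTS.
  exact: measurable_meval.
by apply/funext => y; rewrite !patchE; case: ifPn => // /set_mem /vP.
Qed.

(** The shifted prism is -eps <= x_d <= phi - eps over the same cube; meeting it with the prism
    restores the lower bound 0. *)
Lemma shrunk_gen_prism (n : nat) (phi : 'rV[R]_n -> R) (eps : R) : 0 <= eps ->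
  shrunk_prism (gen_prism phi) eps = gen_prism (fun x => phi x - eps).
Proof.
move=> e0.
have initD (y : 'rV[R]_n.+1) a : rV_init (y + a *: @e_last R n) = rV_init y.
  apply/rowP => i; rewrite !mxE/= (_ : lift _ _ == _ = false) ?mulr0 ?addr0//.
  by apply/negbTE; rewrite eq_sym neq_lift.
have lastD (y : 'rV[R]_n.+1) a : rV_last (y + a *: @e_last R n) = rV_last y + a.
  by rewrite /rV_last !mxE !eqxx mulr1.
apply/seteqP; split => [y [[cy /andP[y0 yphi]] [z [cz /andP[z0 zphi]] zy]]|y].
  have zE : z = y + eps *: @e_last R n by rewrite -zy subrK.
  split => //; rewrite y0/= lerBrDr.
  by move: zphi; rewrite zE initD lastD.
move=> [cy /andP[y0 yphi]]; split; first by split => //; rewrite y0/=; lra.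
exists (y + eps *: @e_last R n); last by rewrite addrK.
by split; rewrite initD ?lastD//; lra.
Qed.

Lemma measurable_integral_rV_snoc (n : nat) (f : 'rV[R]_n.+1 -> \bar R) :
  measurable_fun setT f -> (forall x, (0 <= f x)%E) ->
  measurable_fun setT
    (fun x : 'rV[R]_n => \int[@lebesgue_measure R]_t f (rV_snoc (x, t)))%E.
Proof.
move=> mf f0.
apply: (@measurable_fun_fubini_tonelli_F _ _ _ _ _ (@lebesgue_measure R)
  (f \o @rV_snoc R n)) => [|z]; last exact: f0.
by apply: measurableT_comp mf _; exact: measurable_rV_snoc.
Qed.

End fibers.

(** * Integration of the fiberwise estimate over the cube *)

Theorem lemma4p14 (R : realType) (n : nat) (K : set 'rV[R]_n.+1)
    (hK : reference_prism K) (hrho : rho_hat K = 1)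
    (p : nat) (hp : (0 < p)%N)
    (v : 'rV[R]_n.+1 -> R) (hv : poly_space p K v)
    (eps : R) (heps0 : 0 < eps) (heps : eps <= (8 * p%:R) ^- 2) :
  ((2^-1)%:E * L2norm K v ^+ 2 <= L2norm (shrunk_prism K eps) v ^+ 2)%E.
Proof.
case: hK => phi [lip_phi KE cubeK _]; case: hv => P [sizeP vP].
(* The unit cube lies in [K], in particular its top point (x, 1). *)
have phi1 x : unit_cube x -> 1 <= phi x.
  move=> cx; have : K (rV_snoc (x, 1)).
    apply: cubeK => i; rewrite mxE; case: unliftP => [j _|_]/=; first exact: cx.
    by rewrite ler01 lexx.
  by rewrite KE => -[_]; rewrite rV_initK rV_lastK => /andP[].
pose psi x := phi x - eps.
have mphi := lipschitz_measurable lip_phi.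
have mK : measurable K by rewrite KE; exact: measurable_gen_prism.
have mKe : measurable (gen_prism psi).
  by apply: measurable_gen_prism; exact: measurable_funB.
have subK : gen_prism psi `<=` K.
  by rewrite KE => y [cy /andP[y0 ypsi]]; split => //; rewrite y0/=;
     rewrite /psi in ypsi; lra.
have vPe y : gen_prism psi y -> v y = meval (y ord0) P.
  by move=> /subK/vP.
have mfK := measurable_patch_meval mK vP.
have mfKe := measurable_patch_meval mKe vPe.
have sqr_ge0E (A : set 'rV[R]_n.+1) y : (0 <= ((v \_ A) y ^+ 2)%:E)%E.
  by rewrite lee_fin sqr_ge0.
have -> : shrunk_prism K eps = gen_prism psi.
  by rewrite KE shrunk_gen_prism// ltW.
rewrite !L2norm_sqr (integral_rV_snoc mfK (sqr_ge0E _)).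
rewrite (integral_rV_snoc mfKe (sqr_ge0E _)).
have mFK := measurable_integral_rV_snoc mfK (sqr_ge0E _).
have mFKe := measurable_integral_rV_snoc mfKe (sqr_ge0E _).
have F0 (A : set 'rV[R]_n.+1) (x : 'rV[R]_n) :
    (0 <= \int[@lebesgue_measure R]_t ((v \_ A) (rV_snoc (x, t)) ^+ 2)%:E)%E.
  by apply: integral_ge0 => t _; exact: sqr_ge0E.
(* With 1/2 inside the outer integral, the integrands can be compared fiber by fiber. *)
rewrite -(ge0_integralZl _ _ mFK)//.
apply: ge0_le_integral => //.
- by move=> x _; rewrite mule_ge0// lee_fin invr_ge0.
- exact: measurable_funeM.
move=> x _; have [cx|cx] := pselect (unit_cube x); last first.
  (* Outside the cube the fiber of [K] is empty and the left side is 0. *)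
  rewrite integral0_eq ?mule0// => t _.
  rewrite patchE ifF ?expr0n//; apply/negbTE/negP => /set_mem.
  by rewrite KE => -[+ _]; rewrite rV_initK.
(* Together with phi >= 1 this makes the shrunk fiber an interval of positive length. *)
have eps1 : eps < 1.
  rewrite (le_lt_trans heps)// invf_lt1 ?exprn_gt0 ?mulr_gt0 ?ltr0n//.
  by rewrite exprn_egt1// -natrM ltr1n (leq_trans _ (leq_pmulr 8 hp)).
have phi1x := phi1 x cx.
rewrite (integral_fiber vPe cx); last by rewrite /psi; lra.
have vP' y : gen_prism phi y -> v y = meval (y ord0) P.
  by rewrite -KE; exact: vP.
rewrite KE (integral_fiber vP' cx); last by lra.
rewrite lee_fin ler_pdivrMl//; apply: (antideriv_sqr_shrink hp) => //.
exact: leq_trans (size_fiber_poly _ _) sizeP.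
Qed.
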